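(* Let $\mathcal{A}$ be a unital $C^*$-algebra and let $a,b\in\mathcal{A}$. Then the following conditions are equivalent: (1) $\|a+b\|_{\nabla}=\|a\|_{\nabla}+\|b\|_{\nabla}$. (2) There exists a sequence $\{f_n\}$ in $\mathcal{S}(\mathcal{A})$ such that $$\lim_{n\to\infty}\mathcal{R}\left(f_n(b^*a)+\overline{f_n(a)}\,f_n(b)\right)=2\|a\|_{\nabla}\|b\|_{\nabla}.$$
   Context: $\mathcal{A}$ is a unital $C^*$-algebra with unit $1$, and $\mathcal{S}(\mathcal{A})=\{f\in\mathcal{A}': f(1)=\|f\|=1\}$ is its set of states. $\mathcal{R}(z)$ denotes the real part of $z\in\mathbb{C}$. With $\nabla$ the arithmetic mean $s\nabla t=\frac{s+t}{2}$, for $a\in\mathcal{A}$, $$\|a\|_{\nabla}=\sup\left\{\sqrt{\tfrac12\left(|f(a)|^2+f(a^*a)\right)}: f\in\mathcal{S}(\mathcal{A})\right\}.$$ *)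

(* Defs.v *)
From HB Require Import structures.
From mathcomp Require Import all_boot all_order all_algebra.
From mathcomp Require Import complex.
From mathcomp Require Import all_classical all_reals all_analysis.

Set Implicit Arguments.
Unset Strict Implicit.
Unset Printing Implicit Defensive.

Import Order.TTheory GRing.Theory Num.Theory.
Import numFieldNormedType.Exports.

Local Open Scope classical_set_scope.
Local Open Scope ring_scope.

(* The scalar field is R[i] for a realType R. Norms of a normed module over
   R[i] take their values in R[i] (they are nonnegative, hence real).

   The unit and the product are fields of the mixin because Hierarchy Builder
   refuses a structure inheriting from both normed modules and rings (the join
   would have to be declared before numDomainType). The algebra structure is recovered
   by the instances below, so that x * y, 1 and x ^+ n have their usual
   meaning in A. The condition cstar_oner_neq0 excludes the zero algebra, which
   has no states. *)
HB.mixin Record CompleteNormedModule_isCStarAlgebra (R : realType) A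
    & CompleteNormedModule R[i] A := {
  cstar_one : A;
  cstar_mul : A -> A -> A;
  cstar_mulA : associative cstar_mul;
  cstar_mul1r : left_id cstar_one cstar_mul;
  cstar_mulr1 : right_id cstar_one cstar_mul;
  cstar_mulDl : left_distributive cstar_mul +%R;
  cstar_mulDr : right_distributive cstar_mul +%R;
  cstar_oner_neq0 : cstar_one != 0;
  cstar_scalerAl : forall (l : R[i]) (x y : A),
    l *: cstar_mul x y = cstar_mul (l *: x) y;
  cstar_scalerAr : forall (l : R[i]) (x y : A),
    l *: cstar_mul x y = cstar_mul x (l *: y);
  star : A -> A;
  starK : involutive star;
  starD : {morph star : x y / x + y};
  starZ : forall (l : R[i]) (x : A), star (l *: x) = conjc l *: star x;
  starM : forall x y : A, star (cstar_mul x y) = cstar_mul (star y) (star x);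
  cstar_normM_le : forall x y : A, `|cstar_mul x y| <= `|x| * `|y|;
  cstar_norm_starM : forall x : A, `|cstar_mul (star x) x| = `|x| ^+ 2
}.

#[short(type="cstarAlgType")]
HB.structure Definition CStarAlgebra (R : realType) :=
  {A of CompleteNormedModule R[i] A & CompleteNormedModule_isCStarAlgebra R A}.

#[non_forgetful_inheritance]
HB.instance Definition _ (R : realType) (A : cstarAlgType R) :=
  GRing.Zmodule_isNzRing.Build A (@cstar_mulA R A) (@cstar_mul1r R A)
    (@cstar_mulr1 R A) (@cstar_mulDl R A) (@cstar_mulDr R A)
    (@cstar_oner_neq0 R A).

#[non_forgetful_inheritance]
HB.instance Definition _ (R : realType) (A : cstarAlgType R) :=
  GRing.Lmodule_isLalgebra.Build R[i] A (@cstar_scalerAl R A).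

#[non_forgetful_inheritance]
HB.instance Definition _ (R : realType) (A : cstarAlgType R) :=
  GRing.Lalgebra_isAlgebra.Build R[i] A (@cstar_scalerAr R A).

Section states.
Context {R : realType} {A : cstarAlgType R}.
Implicit Types (f : {linear A -> R[i]^o}) (a : A).

(* Normc.normc is the R-valued modulus on R[i]. *)
Definition dual_norm f : R :=
  sup [set Normc.normc (f x) | x in [set x : A | `|x| <= 1]].

(* Continuity is required separately: sup of an unbounded set is a junk value. *)
Definition states : set {linear A -> R[i]^o} :=
  [set f : {linear A -> R[i]^o} |
    [/\ continuous (f : A -> R[i]^o), f 1 = 1 & dual_norm f = 1]].

(* f (star a * a) is a nonnegative element of R[i] when f is a state; Re only
   moves it to R. *)
Definition nabla_norm a : R :=
  sup [set Num.sqrt (2^-1 * (Normc.normc (f a) ^+ 2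
                             + complex.Re (f (star a * a)))) | f in states].

End states.
Arguments states {R} A.

(* Main.v *)
(* For a state f put Q_f(x) = (|f(x)|^2 + f(x^* x)) / 2, so that
   ||x||_nabla = sup_f sqrt (Q_f(x)), and let
   B_f(a, b) = Re (f(b^* a) + conj (f(a)) f(b)).  Then
   Q_f(a + b) = Q_f(a) + Q_f(b) + B_f(a, b), and since Q_f >= 0, Cauchy-Schwarz
   gives B_f(a, b) <= 2 sqrt (Q_f(a) Q_f(b)) <= 2 ||a||_nabla ||b||_nabla.
   Both implications follow by taking states that are nearly optimal, for a + b
   in one direction, and for a and b at once in the other.

   Two facts on states are needed.  They exist, by Hahn-Banach (otherwise the
   suprema are junk).  They are positive, which amounts to
   ||t - x^* x|| <= t for some t; this is proved without spectral theory, from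
   square roots obtained as limits of an explicit iteration. *)
From HB Require Import structures.
Require Import Defs.
From mathcomp Require Import all_boot all_order all_algebra.
From mathcomp Require Import complex.
From mathcomp Require Import all_classical all_reals all_analysis.
From mathcomp Require Import ring lra.

Import Order.TTheory GRing.Theory Num.Theory.
Import numFieldNormedType.Exports.

Local Open Scope classical_set_scope.
Local Open Scope ring_scope.

(** * The C*-norm *)

Section cstar_norm.
Context {R : realType} {A : cstarAlgType R}.
Implicit Types (x y z h k : A) (t : R) (l : R[i]).
Local Open Scope complex_scope.

(** The norm takes values in [R[i]]; this copy in [R] makes real order reasoning available. *)
Definition nrm x : R := complex.Re `|x|.

Lemma normE x : `|x| = (nrm x)%:C.
Proof. by have /ger0_Im := normr_ge0 x; rewrite /nrm; case: `|x| => a b /= ->. Qed.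

Lemma normcE l : `|l| = (Normc.normc l)%:C.
Proof. by []. Qed.

Lemma nrm_ge0 x : 0 <= nrm x.
Proof. by rewrite -lecR -normE; exact: normr_ge0. Qed.

Lemma nrm_le x t : (nrm x <= t) = (`|x| <= t%:C).
Proof. by rewrite normE lecR. Qed.

Lemma nrmD x y : nrm (x + y) <= nrm x + nrm y.
Proof. by rewrite nrm_le rmorphD /= -!normE ler_normD. Qed.

Lemma nrmN x : nrm (- x) = nrm x.
Proof. by rewrite /nrm normrN. Qed.

Lemma nrmB x y : nrm (x - y) <= nrm x + nrm y.
Proof. by rewrite -(nrmN y) nrmD. Qed.

Lemma nrm0 : nrm (0 : A) = 0.
Proof. by rewrite /nrm normr0. Qed.

Lemma nrm0_eq0 x : nrm x = 0 -> x = 0.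
Proof. by move=> x0; apply/eqP; rewrite -normr_eq0 normE x0. Qed.

Lemma nrmZ l x : nrm (l *: x) = Normc.normc l * nrm x.
Proof.
by apply: complexI; rewrite rmorphM /= -!normE normrZ.
Qed.

Lemma nrmZr t x : nrm (t%:C *: x) = `|t| * nrm x.
Proof. by rewrite nrmZ /= expr0n addr0 sqrtr_sqr. Qed.

Lemma nrmM x y : nrm (x * y) <= nrm x * nrm y.
Proof. by rewrite nrm_le rmorphM /= -!normE; exact: cstar_normM_le. Qed.

Lemma nrm_starM x : nrm (star x * x) = nrm x ^+ 2.
Proof. by apply: complexI; rewrite rmorphXn /= -!normE; exact: cstar_norm_starM. Qed.

Lemma starMr x y : star (x * y) = star y * star x.
Proof. exact: starM. Qed.

Lemma star1 : star (1 : A) = 1.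
Proof. by rewrite -[LHS]mulr1 -{2}(starK (1 : A)) -starMr mulr1 starK. Qed.

Lemma starZr t x : star (t%:C *: x) = t%:C *: star x.
Proof. by rewrite starZ conjc_real. Qed.

Lemma star0 : star (0 : A) = 0.
Proof. by rewrite -(scale0r 1) starZ rmorph0 !scale0r. Qed.

Lemma starN x : star (- x) = - star x.
Proof. by rewrite -scaleN1r starZ rmorphN1 scaleN1r. Qed.

Lemma starB x y : star (x - y) = star x - star y.
Proof. by rewrite starD starN. Qed.

(** The C*-identity and submultiplicativity give [nrm y ^+ 2 <= nrm (star y) * nrm y]; cancel, then
    apply this to [x] and to [star x]. *)
Lemma nrm_star x : nrm (star x) = nrm x.
Proof.
have le y : nrm y <= nrm (star y).
  have [->|y0] := eqVneq (nrm y) 0; first exact: nrm_ge0.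
  have y_gt0 : 0 < nrm y by rewrite lt0r y0 nrm_ge0.
  by rewrite -(ler_pM2r y_gt0) -expr2 -nrm_starM nrmM.
by apply/eqP; rewrite eq_le le -{2}(starK x) le.
Qed.

Lemma nrm1 : nrm (1 : A) = 1.
Proof.
have := nrm_starM 1; rewrite star1 mulr1 => /eqP; rewrite expr2 -subr_eq0.
rewrite -[X in X - _]mulr1 -mulrBr mulf_eq0 => /orP[/eqP/nrm0_eq0 /eqP|].
  by rewrite oner_eq0.
by rewrite subr_eq0 => /eqP <-.
Qed.

Lemma starM_eq0 x : star x * x = 0 -> x = 0.
Proof.
move=> xx; apply: nrm0_eq0; apply/eqP.
by rewrite -sqrf_eq0 -nrm_starM xx nrm0.
Qed.

Lemma sa_sqr_eq0 k : star k = k -> k * k = 0 -> k = 0.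
Proof. by move=> ks kk; apply: starM_eq0; rewrite ks. Qed.

(** The dominating sequence [s] is nondecreasing and bounded, so [u] is Cauchy; letting [m] tend to
    infinity gives the explicit error bound. *)
Lemma nrm_cvg (u : nat -> A) (s : nat -> R) (M : R) :
  (forall n, s n <= M) ->
  (forall n m, (n <= m)%N -> nrm (u m - u n) <= s m - s n) ->
  exists2 z, forall n, nrm (z - u n) <= lim (s @ \oo) - s n & cvgn s.
Proof.
move=> sM us.
have snd : nondecreasing_seq s.
  by move=> n m nm; rewrite -subr_ge0 (le_trans (nrm_ge0 _) (us _ _ nm)).
have scvg : cvgn s.
  by apply: nondecreasing_is_cvgn => //; exists M => _ [n _ <-].
have ucvg : cvgn u.
  apply/cauchy_cvgP/cauchy_ballP => e e0.
  have er : e = (complex.Re e)%:C.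
    by move: e0 => /ltW/ger0_Im; case: (e) => a b /= ->.
  have re0 : 0 < complex.Re e by rewrite -ltcR -er.
  have re2 : 0 < complex.Re e / 2 by rewrite divr_gt0.
  have /cvgrPdist_lt/(_ _ re2)[n _ sn] := scvg.
  rewrite !near_simpl; near=> a b.
  have na : (n <= a)%N by near: a; exists n.
  have nb : (n <= b)%N by near: b; exists n.
  have sa := sn a na; have sb := sn b nb.
  have su i (ni : (n <= i)%N) : nrm (u i - u n) < complex.Re e / 2.
    apply: le_lt_trans (us _ _ ni) _.
    apply: le_lt_trans (sn n (leqnn n)); rewrite /= ger0_norm.
      by rewrite lerD2r; exact: nondecreasing_cvgn_le.
    by rewrite subr_ge0; exact: nondecreasing_cvgn_le.
  rewrite -ball_normE /= er normE ltcR.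
  have -> : u a - u b = (u a - u n) - (u b - u n) by rewrite opprB addrA subrK.
  apply: le_lt_trans (nrmB _ _) _; rewrite (splitr (complex.Re e)).
  by rewrite ltrD // su.
exists (lim (u @ \oo)) => // n.
apply/ler_addgt0Pr => e e0.
have e0' : 0 < e%:C by rewrite ltcR.
have /cvgrPdist_lt/(_ _ e0')[m _ um] := ucvg.
have := um (maxn n m) (leq_maxr _ _); rewrite /= normE ltcR => lt_e.
rewrite -(subrK (u (maxn n m)) (lim _)) -addrA addrC.
apply: le_trans (nrmD _ _) _; apply: lerD (ltW lt_e).
by apply: le_trans (us _ _ (leq_maxl _ _)) _; rewrite lerD2r nondecreasing_cvgn_le.
Unshelve. all: by end_near. Qed.

End cstar_norm.

(** * Square roots *)

Section square_root.
Context {R : realType} {A : cstarAlgType R}.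
Implicit Types (x y z h k : A) (t : R) (l : R[i]).
Local Open Scope complex_scope.

Lemma le_lim_gap (s : nat -> R) (a c : R) :
  cvgn s -> (forall n, a <= c * (lim (s @ \oo) - s n)) -> a <= 0.
Proof.
move=> scvg acs.
have cvg0 : c * (lim (s @ \oo) - s n) @[n --> \oo] -->
    c * (lim (s @ \oo) - lim (s @ \oo)).
  by apply: cvgMl_tmp; apply: cvgB => //; exact: cvg_cst.
rewrite subrr mulr0 in cvg0.
rewrite -(cvg_lim (@Rhausdorff R) cvg0); apply: limr_ge; first by apply: cvgP cvg0.
by near=> n; exact: acs.
Unshelve. all: by end_near. Qed.

(** Serves to prove identities satisfied by a limit: the defect is bounded by a multiple of a gap
    that tends to 0. *)
Lemma nrm_gap_eq0 x (s : nat -> R) (c : R) :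
  cvgn s -> (forall n, nrm x <= c * (lim (s @ \oo) - s n)) -> x = 0.
Proof.
move=> scvg xs; apply/nrm0_eq0/eqP.
by rewrite eq_le nrm_ge0 andbT; exact: le_lim_gap scvg xs.
Qed.

(* [1 - sqrt (1 - y)] is the limit of the iteration [z' = (y + z ^ 2) / 2],
   whose increments are dominated by those of the scalar iteration at
   [y = 1]. *)
Lemma one_sub_sqrt y : nrm y <= 1 -> exists z,
  [/\ nrm z <= 1, z + z = y + z * z, star y = y -> star z = z
    & forall x, x * y = y * x -> x * z = z * x].
Proof.
move=> y1.
pose u := fix u n : A := if n is n'.+1 then (2^-1 : R)%:C *: (y + u n' * u n') else 0.
pose s := fix s n : R := if n is n'.+1 then 2^-1 * (1 + s n' * s n') else 0.
have uS n : u n.+1 + u n.+1 = y + u n * u n.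
  by rewrite /= -scalerDl -rmorphD /= -[X in X + X]div1r -splitr scale1r.
have ucomm x : x * y = y * x -> forall n, x * u n = u n * x.
  move=> xy; elim=> [|n IH] /=; first by rewrite mulr0 mul0r.
  by rewrite -scalerAr -scalerAl mulrDr mulrDl xy mulrA IH -!mulrA IH.
(* The iterates commute with [y], hence with each other, so a difference of their squares factors;
   this drives the induction on increments. *)
have uucomm n m : u n * u m = u m * u n.
  by apply: (ucomm); symmetry; exact: (ucomm).
have s0 n : 0 <= s n.
  case: n => //= n.
  by rewrite mulr_ge0 ?invr_ge0// addr_ge0// -expr2 sqr_ge0.
have s1 n : s n <= 1.
  elim: n => //= n IH; have : s n * s n <= 1 by rewrite mulr_ile1.
  by lra.
have us n : nrm (u n) <= s n.
  elim: n => [|n IH] /=; first by rewrite nrm0.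
  rewrite nrmZr ger0_norm ?invr_ge0// ler_pM2l ?invr_gt0//.
  apply: le_trans (nrmD _ _) _; apply: lerD => //.
  by apply: le_trans (nrmM _ _) _; rewrite ler_pM ?nrm_ge0.
have dS n : nrm (u n.+1 - u n) <= s n.+1 - s n.
  elim: n => [|n IH]; first by rewrite /= !subr0 mulr0 mul0r !addr0 nrmZr
    ger0_norm ?invr_ge0// ler_pM2l ?invr_gt0.
  have -> : s n.+2 - s n.+1 = 2^-1 * ((s n.+1 - s n) * (s n.+1 + s n)).
    by rewrite /=; ring.
  have -> : u n.+2 - u n.+1 = (2^-1 : R)%:C *: ((u n.+1 - u n) * (u n.+1 + u n)).
    rewrite -[in LHS]/(u n.+2) [u n.+2]/(_ *: _) [X in _ - X]/(_ *: _).
    rewrite -scalerBr; congr (_ *: _).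
    rewrite -/(u n.+1) opprD addrACA subrr add0r mulrDr !mulrBl (uucomm n n.+1).
    by rewrite addrA subrK.
  rewrite nrmZr ger0_norm ?invr_ge0// ler_pM2l ?invr_gt0//.
  apply: le_trans (nrmM _ _) _; apply: ler_pM; rewrite ?nrm_ge0//.
  by apply: le_trans (nrmD _ _) _; rewrite lerD.
have du n m : (n <= m)%N -> nrm (u m - u n) <= s m - s n.
  move=> /subnK <-; elim: (m - n)%N => [|p IH]; first by rewrite !subrr nrm0.
  rewrite addSn; set q := (p + n)%N in IH *.
  have -> : u q.+1 - u n = (u q.+1 - u q) + (u q - u n) by rewrite addrA subrK.
  have -> : s q.+1 - s n = (s q.+1 - s q) + (s q - s n) by ring.
  by apply: le_trans (nrmD _ _) _; rewrite lerD.
have [z zu scvg] := nrm_cvg _ _ _ s1 du.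
set L := lim (s @ \oo) in zu.
have L1 : L <= 1 by apply: limr_le => //; near=> n.
have gap0 n : 0 <= L - s n by apply: le_trans (nrm_ge0 _) (zu n).
have z1 : nrm z <= 1.
  rewrite -(subrK (u 0%N) z); apply: le_trans (nrmD _ _) _.
  by rewrite nrm0 addr0; apply: le_trans (zu 0%N) _; rewrite /= subr0.
exists z; split=> //.
(* Subtracting the recurrence leaves two terms [z - u n.+1] and two products with a factor [z - u n]
   and a factor of norm at most 1, whence the constant 4. *)
- apply/eqP; rewrite -subr_eq0; apply/eqP/(nrm_gap_eq0 _ s 4 scvg) => n.
  have -> : z + z - (y + z * z) = ((z - u n.+1) + (z - u n.+1))
       - (z * (z - u n) + (z - u n) * u n).
    rewrite addrACA -opprD uS mulrBr mulrBl addrA subrK.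
    rewrite -[RHS]addrA -opprD; congr (_ - _).
    by rewrite -addrA (addrC (u n * u n)) subrK.
  have gapS : nrm (z - u n.+1) <= L - s n.
    apply: le_trans (zu _) _; rewrite lerD2l lerN2 -subr_ge0.
    exact: le_trans (nrm_ge0 _) (dS n).
  apply: le_trans (nrmB _ _) _.
  have := nrmD (z - u n.+1) (z - u n.+1).
  have := nrmD (z * (z - u n)) ((z - u n) * u n).
  have : nrm (z * (z - u n)) <= L - s n.
    apply: le_trans (nrmM _ _) _; rewrite -[leRHS]mul1r.
    by rewrite ler_pM ?nrm_ge0.
  have : nrm ((z - u n) * u n) <= L - s n.
    apply: le_trans (nrmM _ _) _; rewrite -[leRHS]mulr1.
    by rewrite ler_pM ?nrm_ge0// (le_trans (us n)).
  by rewrite -/L; lra.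
- move=> ys; apply/eqP; rewrite -subr_eq0; apply/eqP/(nrm_gap_eq0 _ s 2 scvg) => n.
  have usa : star (u n) = u n.
    elim: {+}n => [|m IH] /=; first exact: star0.
    by rewrite starZr starD ys starMr IH.
  have -> : star z - z = star (z - u n) - (z - u n).
    by rewrite starB usa opprB addrA subrK.
  apply: le_trans (nrmB _ _) _; rewrite nrm_star.
  by have := zu n; rewrite -/L; lra.
- move=> x xy; apply/eqP; rewrite -subr_eq0.
  apply/eqP/(nrm_gap_eq0 _ s (2 * nrm x) scvg) => n.
  have -> : x * z - z * x = x * (z - u n) - (z - u n) * x.
    by rewrite mulrBr mulrBl (ucomm _ xy) opprB addrA subrK.
  apply: le_trans (nrmB _ _) _.
  rewrite -mulrA mulr_natl mulr2n; apply: lerD; apply: le_trans (nrmM _ _) _.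
    by rewrite ler_wpM2l ?nrm_ge0.
  by rewrite mulrC ler_wpM2l ?nrm_ge0.
Unshelve. all: by end_near. Qed.

End square_root.

(** * Positive elements *)

Section positivity.
Context {R : realType} {A : cstarAlgType R}.
Implicit Types (x y z h k m w : A) (t : R) (l : R[i]).
Local Open Scope complex_scope.

(* For self-adjoint [h] the norm bound says that the spectrum of [h] lies in
   [[0, 2 t]]. *)
Definition psd h :=
  star h = h /\ exists2 t : R, 0 <= t & nrm (t%:C *: 1 - h) <= t.

Lemma psd0 : psd 0.
Proof.
split; first exact: star0.
by exists 0; rewrite // scale0r subrr nrm0.
Qed.

Lemma psdD h k : psd h -> psd k -> psd (h + k).
Proof.
move=> [hs [t t0 ht]] [ks [s s0 ks']]; split; first by rewrite starD hs ks.
exists (t + s); first exact: addr_ge0.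
rewrite rmorphD /= scalerDl opprD addrACA.
by apply: le_trans (nrmD _ _) _; exact: lerD.
Qed.

Lemma psdZ (c : R) h : 0 <= c -> psd h -> psd (c%:C *: h).
Proof.
move=> c0 [hs [t t0 ht]]; split; first by rewrite starZr hs.
exists (c * t); first exact: mulr_ge0.
by rewrite rmorphM /= -scalerA -scalerBr nrmZr ger0_norm// ler_wpM2l.
Qed.

(** If [z + z = y + z * z], the right-hand side is [1 - y], so [1 - z] is a square root of
    [1 - y]. *)
Lemma one_sub_sqr z : (1 - z) * (1 - z) = 1 - (z + z - z * z).
Proof.
rewrite mulrBr mulr1 mulrBl mul1r -addrA -opprD; congr (_ - _).
by rewrite addrA.
Qed.

(** For [t > 0], [y = 1 - h / t] has norm at most 1, and a root [1 - z] of [1 - y = h / t] is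
    rescaled by [sqrt t]. If [t = 0], then [h = 0]. *)
Lemma psd_sqrt h : psd h -> exists k,
  [/\ psd k, k * k = h & forall x, x * h = h * x -> x * k = k * x].
Proof.
move=> [hs [t t0 ht]].
have [t00|tn0] := eqVneq t 0.
  exists 0; split; [exact: psd0| |by move=> x _; rewrite mulr0 mul0r].
  rewrite mulr0; apply/esym/nrm0_eq0/eqP; rewrite eq_le nrm_ge0 andbT.
  by move: ht; rewrite t00 scale0r sub0r nrmN.
have tgt0 : 0 < t by rewrite lt0r tn0.
have tC : t%:C != 0 :> R[i] by rewrite fmorph_eq0.
pose y := 1 - t^-1%:C *: h.
have ht' : y = t^-1%:C *: (t%:C *: 1 - h).
  by rewrite scalerBr scalerA -rmorphM /= mulVf// scale1r.
have ys : star y = y by rewrite starB star1 starZr hs.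
have y1 : nrm y <= 1.
  by rewrite ht' nrmZr ger0_norm ?invr_ge0// -(mulVf tn0) ler_pM2l ?invr_gt0.
have [z [z1 zz /(_ ys) zs zcomm]] := one_sub_sqrt _ y1.
have st : Num.sqrt t * Num.sqrt t = t by rewrite -expr2 sqr_sqrtr.
exists ((Num.sqrt t)%:C *: (1 - z)); split.
- split; first by rewrite starZr starB star1 zs.
  exists (Num.sqrt t); first exact: sqrtr_ge0.
  rewrite -scalerBr opprB addrC subrK nrmZr ger0_norm ?sqrtr_ge0//.
  by rewrite ler_piMr ?sqrtr_ge0.
- rewrite -scalerAl -scalerAr scalerA -rmorphM /= st one_sub_sqr zz addrK.
  by rewrite subKr scalerA -rmorphM /= mulfV// scale1r.
- move=> x xh; have xy : x * y = y * x.
    by rewrite mulrBr mulrBl mulr1 mul1r -scalerAr -scalerAl xh.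
  by rewrite -scalerAr -scalerAl mulrBr mulrBl mulr1 mul1r (zcomm _ xy).
Qed.

(** The cross terms of the product cancel because [k] and [m] commute. *)
Lemma sa_cartesian k m : star k = k -> star m = m -> k * m = m * k ->
  star (k + 'i *: m) = k - 'i *: m /\
  star (k + 'i *: m) * (k + 'i *: m) = k * k + m * m.
Proof.
move=> ks ms km; have e : star (k + 'i *: m) = k - 'i *: m.
  rewrite starD starZ ks ms -scaleNr; congr (_ + _ *: _).
  by apply/eqP; rewrite eq_complex /= oppr0 !eqxx.
split=> //; rewrite e mulrBl !mulrDr -!scalerAl -!scalerAr km.
rewrite opprD addrA addrK scalerA -scaleNr; congr (_ + _).
rewrite -[RHS]scale1r; congr (_ *: _).
by apply/eqP; rewrite eq_complex /=; apply/andP; split; apply/eqP; ring.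
Qed.

(* For [nrm k <= 1] put [s := sqrt (1 - k ^ 2)]: then [k + i s] is unitary, so
   that [nrm (1 - k ^ 2) = nrm s ^ 2 <= 1]. *)
Lemma psd_sqr k : star k = k -> psd (k * k).
Proof.
move=> ks.
(* Divide by [1 + nrm k], which is positive even when [k = 0]. *)
wlog k1 : k ks / nrm k <= 1.
  move=> H; pose t := 1 + nrm k.
  have t0 : 0 < t by rewrite ltr_pwDl// nrm_ge0.
  have tC : t%:C != 0 :> R[i] by rewrite fmorph_eq0 gt_eqF.
  have -> : k * k = (t * t)%:C *: ((t^-1%:C *: k) * (t^-1%:C *: k)).
    rewrite -scalerAl -scalerAr !scalerA -!rmorphM /= -mulrA mulrA.
    by rewrite mulfK ?gt_eqF// divff ?gt_eqF// scale1r.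
  apply: psdZ; first by rewrite mulr_ge0// ltW.
  apply: H; first by rewrite starZr ks.
  rewrite nrmZr ger0_norm; last by rewrite invr_ge0 ltW.
  rewrite mulrC ler_pdivrMr// mul1r.
  by rewrite lerDr.
have kk1 : nrm (k * k) <= 1.
  by apply: le_trans (nrmM _ _) _; rewrite mulr_ile1 ?nrm_ge0.
split; first by rewrite starMr ks.
exists 1; first by []; rewrite scale1r.
have [z [_ zz zs zcomm]] := one_sub_sqrt _ kk1.
pose s := 1 - z.
have ss : s * s = 1 - k * k by rewrite one_sub_sqr zz addrK.
have sst : star s = s by rewrite starB star1 zs// starMr ks.
have kcs : k * s = s * k.
  by rewrite mulrBr mulrBl mulr1 mul1r (zcomm k)// mulrA.
have [us uu] := sa_cartesian _ _ ks sst kcs.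
set u := k + _ in us uu.
have u1 : nrm u = 1.
  apply/eqP; rewrite -(@eqrXn2 _ 2) ?nrm_ge0// expr1n -nrm_starM uu ss.
  by rewrite addrC subrK nrm1.
(* [u - star u = 2 i s], and both [u] and [star u] have norm 1. *)
have s1 : nrm s <= 1.
  have us2 : u - star u = ('i + 'i) *: s.
    by rewrite us /u opprB (addrC k) addrACA subrr addr0 -scalerDl.
  have : nrm (('i + 'i) *: s) <= 2.
    by rewrite -us2; apply: le_trans (nrmB _ _) _; rewrite nrm_star u1.
  rewrite nrmZ /= addr0 expr0n add0r sqrtr_sqr ger0_norm//; lra.
by rewrite -ss; apply: le_trans (nrmM _ _) _; rewrite mulr_ile1 ?nrm_ge0.
Qed.

Lemma addrr_eq0 x : x + x = 0 -> x = 0.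
Proof.
move=> /eqP; rewrite -mulr2n -scaler_nat scaler_eq0 pnatr_eq0 /= => /eqP.
exact.
Qed.

(** With [k] and [m] commuting roots of [h] and [- h], the element [z = k + i m] has
    [star z * z = h - h = 0]. So [z = 0], and [z + star z = 2 k] vanishes. *)
Lemma psd_anti h : psd h -> psd (- h) -> h = 0.
Proof.
move=> /psd_sqrt[k [[ks _] kk kcomm]] /psd_sqrt[m [[ms _] mm _]].
have km : k * m = m * k.
  apply/esym/kcomm.
  by rewrite -[h]opprK -mm mulrN mulNr mulrA.
have [zs zz] := sa_cartesian _ _ ks ms km.
move: zz; rewrite kk mm subrr => /starM_eq0 z0.
have : k + k = 0.
  rewrite -[RHS](addr0 0) -[X in _ = _ + X]star0 -z0 zs addrACA subrr.
  by rewrite addr0.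
by move=> /addrr_eq0 k0; rewrite -kk k0 mulr0.
Qed.

(** Twice this element is the sum of the squares of the self-adjoint elements [y + star y] and
    [i (y - star y)]. *)
Lemma psd_starD_starr y : psd (star y * y + y * star y).
Proof.
set w := _ + _.
suff /(psdZ 2^-1) : psd (w + w).
  rewrite scalerDr -scalerDl -rmorphD /= -[X in X + X]div1r -splitr scale1r.
  by apply; rewrite invr_ge0.
have -> : w + w = (y + star y) * (y + star y)
    + ('i *: (y - star y)) * ('i *: (y - star y)).
  rewrite -scalerAl -scalerAr scalerA.
  have -> : 'i * 'i = -1 :> R[i].
    by apply/eqP; rewrite eq_complex /=; apply/andP; split; apply/eqP; ring.
  rewrite scaleN1r !(mulrDr, mulrDl) !(mulrN, mulNr) opprK !opprD !opprK.
  rewrite /w.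
  rewrite addrACA [in RHS]addrACA [X in _ = X + _]addrACA subrr add0r.
  by rewrite [X in _ = _ + X]addrACA subrr addr0.
apply: psdD; apply: psd_sqr; first by rewrite starD starK addrC.
rewrite starZ starB starK -[RHS]opprK -scalerN -scaleNr opprB; congr (_ *: _).
by apply/eqP; rewrite eq_complex /= oppr0 !eqxx.
Qed.

(* If [star y * y = - r ^ 2] and [w = y * r], then both [star w * w] and
   [w * star w] are negatives of squares, and so is their sum, which is also
   positive. *)
Lemma psdN_starM y : psd (- (star y * y)) -> y = 0.
Proof.
have aux w : psd (- (star w * w)) -> psd (- (w * star w)) -> star w * w = 0.
  move=> wl wr.
  have S0 : star w * w + w * star w = 0.
    by apply: psd_anti (psd_starD_starr w) _; rewrite opprD; exact: psdD.
  apply: psd_anti => //.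
  by rewrite (eqP (_ : star w * w == - (w * star w)))// -addr_eq0 S0.
move=> yy; have [r [[rs _] rr _]] := psd_sqrt _ yy.
pose p := star y * y; have ps : star p = p by rewrite starMr starK.
(* For [w = y * r], [- (star w * w)] is the square of [- (star y * y)], and [- (w * star w)] is the
   square of [y * star y]. *)
have w0 : star (y * r) * (y * r) = 0.
  apply: aux; rewrite starMr rs.
    rewrite -mulrA (mulrA (star y)) -[star y * y]opprK -rr mulNr mulrN opprK.
    by rewrite !mulrA -mulrA rr; apply: psd_sqr; rewrite starN ps.
  rewrite -mulrA (mulrA r) rr mulNr mulrN opprK !mulrA -mulrA.
  by apply: psd_sqr; rewrite starMr starK.
suff : p * p = 0 by move=> /(sa_sqr_eq0 _ ps)/starM_eq0.
have pE : p = - (r * r) by rewrite rr opprK.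
rewrite starMr rs -mulrA (mulrA (star y)) -/p {1}pE in w0.
rewrite mulNr mulrN !mulrA -mulrA in w0.
by rewrite pE mulrNN -[LHS]opprK w0 oppr0.
Qed.

(* With [g = sqrt (h ^ 2)] and [m = g - h] (twice the negative part of
   [h = star x * x]), [star (x * m) * (x * m) = m * h * m = - (m * g * m)],
   which forces [m = 0]. *)
Lemma psd_starM x : psd (star x * x).
Proof.
set h := star x * x.
have hs : star h = h by rewrite starMr starK.
have [g [gp gg gcomm]] := psd_sqrt _ (psd_sqr _ hs).
have hg : h * g = g * h by apply: gcomm; rewrite mulrA.
have [r [[rs _] rr rcomm]] := psd_sqrt _ gp.
have hr : h * r = r * h by exact: rcomm.
have gr : g * r = r * g by rewrite -rr mulrA.
have gs : star g = g by case: gp.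
pose m := g - h; have ms : star m = m by rewrite starB gs hs.
have mr : m * r = r * m by rewrite mulrBl mulrBr hr gr.
have hm : h * m = - (g * m).
  by rewrite !mulrBr gg hg opprB.
have rms : star (r * m) = r * m by rewrite starMr ms rs.
have yy : star (x * m) * (x * m) = - ((r * m) * (r * m)).
  rewrite starMr ms -mulrA (mulrA (star x)) -/h hm mulrN; congr (- _).
  by rewrite -rr -mr !mulrA mr -!mulrA mr.
have xm : x * m = 0.
  by apply: psdN_starM; rewrite yy opprK; exact: psd_sqr.
have rm : r * m = 0.
  apply: sa_sqr_eq0 => //; apply/eqP; rewrite -oppr_eq0 -yy.
  by rewrite xm mulr0.
have gm : g * m = 0 by rewrite -rr -mulrA rm mulr0.
(* [m * m = g * m - h * m = 2 g * m = 0]; then [h = g] is positive. *)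
have m0 : m = 0.
  apply: sa_sqr_eq0 => //; rewrite {1}/m mulrBl hm opprK gm addr0//.
by move: m0 => /eqP; rewrite subr_eq0 => /eqP <-.
Qed.

End positivity.

(** * Positivity of states *)

Section state_properties.
Context {R : realType} {A : cstarAlgType R}.
Implicit Types (x y a b h : A) (t : R) (f : {linear A -> R[i]^o}).
Local Open Scope complex_scope.

Lemma normc_sqr (l : R[i]) :
  Normc.normc l ^+ 2 = complex.Re l ^+ 2 + complex.Im l ^+ 2.
Proof. by case: l => u v /=; rewrite sqr_sqrtr// addr_ge0 ?sqr_ge0. Qed.

Lemma normc_ge0 (l : R[i]) : 0 <= Normc.normc l.
Proof. by case: l => u v /=; rewrite sqrtr_ge0. Qed.

Lemma Re_le_normc (l : R[i]) : complex.Re l <= Normc.normc l.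
Proof.
apply: le_trans (ler_norm _) _; rewrite -(@ler_pXn2r _ 2) ?nnegrE ?normc_ge0//.
by rewrite normc_sqr real_normK ?num_real// lerDl sqr_ge0.
Qed.

(** Continuity bounds the values on the unit ball, so [dual_norm f] is a true supremum; then [x] is
    normalized. *)
Lemma state_bound f x : states A f -> Normc.normc (f x) <= nrm x.
Proof.
move=> [fcont _ fnorm].
have /linear_bounded_continuous/linear_boundedP[M [Mreal fM]] := fcont.
pose S := [set Normc.normc (f x) | x in [set x : A | `|x| <= 1]].
have Sub : has_ubound S.
  exists (Normc.normc M + 1) => _ [z /= z1 <-].
  have MM : M < (Normc.normc M + 1)%:C.
    have -> : (Normc.normc M + 1)%:C = `|M| + 1 by rewrite rmorphD.
    by apply: le_lt_trans (real_ler_norm Mreal) _; rewrite ltrDl.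
  have := fM _ MM z; rewrite normcE normE -rmorphM lecR => /le_trans; apply.
  by rewrite ler_piMr ?addr_ge0 ?normc_ge0// nrm_le.
have [x0|x0] := eqVneq (nrm x) 0.
  by rewrite (nrm0_eq0 _ x0) linear0 Normc.normc0 nrm0.
have xgt0 : 0 < nrm x by rewrite lt0r x0 nrm_ge0.
pose y := (nrm x)^-1%:C *: x.
have : Normc.normc (f y) <= 1.
  rewrite -fnorm; apply: ub_le_sup => //; exists y => //=.
  by rewrite normE -[leRHS]/(1%:C) lecR nrmZr ger0_norm ?mulVf// invr_ge0 ltW.
rewrite linearZ /= Normc.normcM /= expr0n addr0 sqrtr_sqr.
rewrite ger0_norm; last by rewrite invr_ge0 ltW.
by rewrite mulrC ler_pdivrMr// mul1r.
Qed.

Lemma state1 f : states A f -> f 1 = 1.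
Proof. by case. Qed.

(* [|f (h + i t)| ^ 2 <= |h| ^ 2 + t ^ 2] for all real [t]. *)
Lemma state_real f h : states A f -> star h = h -> complex.Im (f h) = 0.
Proof.
move=> fs hs.
have ineq t :
    complex.Re (f h) ^+ 2 + (complex.Im (f h) + t) ^+ 2 <= nrm h ^+ 2 + t ^+ 2.
  have ts : star (t%:C *: 1 : A) = t%:C *: 1 by rewrite starZr star1.
  have ht : h * (t%:C *: 1) = (t%:C *: 1) * h.
    by rewrite -scalerAr -scalerAl mulr1 mul1r.
  have [_ e] := sa_cartesian _ _ hs ts ht.
  have fe : f (h + 'i *: (t%:C *: 1)) = f h + 'i * t%:C.
    by rewrite linearD !linearZ /= (state1 _ fs) /GRing.scale /= mulr1.
  have : Normc.normc (f (h + 'i *: (t%:C *: 1))) ^+ 2 <=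
    nrm (h + 'i *: (t%:C *: 1)) ^+ 2.
    by rewrite ler_pXn2r ?nnegrE ?normc_ge0 ?nrm_ge0 ?state_bound.
  rewrite -nrm_starM e fe normc_sqr.
  have -> : complex.Re (f h + 'i * t%:C) = complex.Re (f h).
    case: (f h) => u v /=; ring.
  have -> : complex.Im (f h + 'i * t%:C) = complex.Im (f h) + t.
    case: (f h) => u v /=; ring.
  move=> /le_trans; apply; apply: le_trans (nrmD _ _) _; apply: lerD.
    by rewrite -{1}hs nrm_starM.
  by rewrite -scalerAl -scalerAr mulr1 !nrmZr nrm1 mulr1 -expr2 real_normK ?num_real.
apply/eqP/negPn/negP => c0.
(* With [c] the imaginary part, the inequality reads [Re ^ 2 + c ^ 2 + 2 c t <= nrm h ^ 2]; this [t]
   makes [2 c t = nrm h ^ 2 + 1]. *)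
have := ineq ((nrm h ^+ 2 + 1) / (2 * complex.Im (f h))).
set c := complex.Im (f h) in c0 *; set t := _ / _.
have : 2 * c * t = nrm h ^+ 2 + 1 by rewrite /t; field.
have := sqr_ge0 (complex.Re (f h)); have := sqr_ge0 c.
rewrite sqrrD mulr2n; lra.
Qed.

(** [t - Re (f (star x * x)) <= nrm (t - star x * x) <= t] for the [t] supplied by [psd_starM]. *)
Lemma state_pos f x : states A f -> 0 <= complex.Re (f (star x * x)).
Proof.
move=> fs; have [_ [t t0 ht]] := psd_starM x.
have := le_trans (Re_le_normc _) (le_trans (state_bound _ _ fs) ht).
by rewrite linearB linearZ /= (state1 _ fs) /GRing.scale /= mulr1 raddfB /= gerBl.
Qed.

(** [f] is real on the self-adjoint elements [x + star x] and [i (x - star x)]; this fixes both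
    parts of [f (star x)]. *)
Lemma state_star f x : states A f -> f (star x) = conjc (f x).
Proof.
move=> fs.
have : complex.Im (f (x + star x)) = 0.
  by apply: state_real => //; rewrite starD starK addrC.
have : complex.Im (f ('i *: (x - star x))) = 0.
  apply: state_real => //.
  rewrite starZ starB starK -[RHS]opprK -scalerN -scaleNr opprB.
  by congr (_ *: _); apply/eqP; rewrite eq_complex /= oppr0 !eqxx.
rewrite linearZ linearB linearD /= /GRing.scale /=.
case: (f x) => u v; case: (f (star x)) => u' v' /= e1 e2.
by apply/eqP; rewrite eq_complex /=; apply/andP; split; apply/eqP; lra.
Qed.

(** This is [B_f], and [qform] is [Q_f]. For a state, [form] is twice the polar form of [qform],
    whence the factor 2 in [form_le]. *)
Definition form f a b : R := complex.Re (f (star b * a) + conjc (f a) * f b).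

Definition qform f a : R :=
  2^-1 * (Normc.normc (f a) ^+ 2 + complex.Re (f (star a * a))).

Lemma qform_ge0 f a : states A f -> 0 <= qform f a.
Proof. by move=> fs; rewrite mulr_ge0 ?invr_ge0// addr_ge0 ?sqr_ge0 ?state_pos. Qed.

Lemma qform_le f a : states A f -> qform f a <= nrm a ^+ 2.
Proof.
move=> fs.
have : Normc.normc (f a) ^+ 2 <= nrm a ^+ 2.
  by rewrite ler_pXn2r ?nnegrE ?normc_ge0 ?nrm_ge0 ?state_bound.
have := le_trans (Re_le_normc (f (star a * a))) (state_bound _ _ fs).
rewrite nrm_starM /qform; lra.
Qed.

Lemma qformD f a b : states A f ->
  qform f (a + b) = qform f a + qform f b + form f a b.
Proof.
move=> fs; rewrite /qform /form starD mulrDl !mulrDr !linearD /= !normc_sqr.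
have -> : star a * b = star (star b * a) by rewrite starMr starK.
rewrite (state_star _ _ fs).
case: (f a) => u v; case: (f b) => u' v'; case: (f (star b * a)) => p q.
case: (f (star a * a)) => ? ?; case: (f (star b * b)) => ? ? /=.
by field.
Qed.

Lemma qformZ f t b : qform f (t%:C *: b) = t ^+ 2 * qform f b.
Proof.
rewrite /qform starZr -scalerAl -scalerAr !linearZ /= /GRing.scale /= !normc_sqr.
case: (f b) => u v; case: (f (star b * b)) => p q /=; ring.
Qed.

Lemma formZ f t a b : form f a (t%:C *: b) = t * form f a b.
Proof.
rewrite /form starZr -scalerAl !linearZ /= /GRing.scale /=.
case: (f a) => u v; case: (f b) => u' v'; case: (f (star b * a)) => p q /=; ring.
Qed.

(** Discriminant argument: [qform f (a + t b)] is a nonnegative quadratic polynomial in the real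
    variable [t]. *)
Lemma form_le f a b : states A f ->
  form f a b <= 2 * Num.sqrt (qform f a) * Num.sqrt (qform f b).
Proof.
move=> fs.
have qa := qform_ge0 _ a fs; have qb := qform_ge0 _ b fs.
set B := form f a b.
have pos t : 0 <= qform f a + t ^+ 2 * qform f b + t * B.
  by rewrite -qformZ -formZ -qformD// qform_ge0.
have disc : B ^+ 2 <= 4 * qform f a * qform f b.
  have [b0|b0] := eqVneq (qform f b) 0.
    have [->|B0] := eqVneq B 0.
      by rewrite b0 mulr0 expr2 mul0r.
    (* The polynomial is affine here, and at this [t] it would equal -1. *)
    have := pos (- (qform f a + 1) / B).
    by rewrite b0 mulr0 addr0 divfK//; lra.
  have bp : 0 < qform f b by rewrite lt0r b0.
  (* The minimizer of the quadratic. *)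
  have := pos (- B / (2 * qform f b)).
  rewrite -(pmulr_lge0 _ (_ : 0 < 4 * qform f b)); last by rewrite mulr_gt0.
  have -> : (qform f a + (- B / (2 * qform f b)) ^+ 2 * qform f b
     + - B / (2 * qform f b) * B) * (4 * qform f b) =
    4 * qform f a * qform f b - B ^+ 2.
    by field.
  by rewrite subr_ge0.
apply: le_trans (ler_norm _) _.
rewrite -(@ler_pXn2r _ 2) ?nnegrE ?normr_ge0 ?mulr_ge0 ?sqrtr_ge0//.
rewrite real_normK ?num_real// !exprMn !sqr_sqrtr//.
by apply: le_trans disc _; rewrite -natrX.
Qed.

End state_properties.

(** * Existence of states *)

Section hahn_banach.
Context {R : realType} {V : lmodType R[i]}.
Implicit Types (p q : V -> R) (x y : V) (r t : R).
Local Open Scope complex_scope.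

(** Only real scalars occur, as the functional obtained is real-linear and is complexified
    afterwards. Homogeneity as an inequality implies equality, by scaling back with [r^-1]. *)
Definition sublinear p :=
  (forall x y, p (x + y) <= p x + p y) /\
  (forall r x, 0 <= r -> p (r%:C *: x) <= r * p x).

Lemma sublinear0 p : sublinear p -> p 0 = 0.
Proof.
move=> [pD pZ]; apply/eqP; rewrite eq_le.
have := pZ 0 0 (lexx 0); rewrite scaler0 mul0r => -> /=.
by have := pD 0 0; rewrite addr0 lerDl.
Qed.

Lemma sublinearZ p r x : sublinear p -> 0 <= r -> p (r%:C *: x) = r * p x.
Proof.
move=> ps; rewrite le_eqVlt => /predU1P[<-|r0].
  by rewrite scale0r mul0r sublinear0.
have [_ pZ] := ps; apply/eqP; rewrite eq_le (pZ _ _ (ltW r0)) /=.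
have ri : 0 <= r^-1 by rewrite invr_ge0 ltW.
have := pZ _ (r%:C *: x) ri.
rewrite scalerA -rmorphM /= mulVf ?gt_eqF// scale1r -(ler_pM2l r0).
by rewrite mulrA divff ?gt_eqF// mul1r.
Qed.

Lemma sublinearN p x : sublinear p -> - p (- x) <= p x.
Proof.
move=> ps; have [pD _] := ps; have := pD x (- x).
rewrite subrr sublinear0//; lra.
Qed.

(* [q x] is the infimum of [p (x + t y) - t p y] over [t >= 0]. *)
Lemma sublinear_step p y : sublinear p ->
  exists q, [/\ sublinear q, forall x, q x <= p x & q (- y) <= - p y].
Proof.
move=> ps; have [pD pZ] := ps.
pose S x := [set p (x + t%:C *: y) - t * p y | t in [set t : R | 0 <= t]].
pose q x := inf (S x).
have qlb x t : 0 <= t -> q x <= p (x + t%:C *: y) - t * p y.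
  move=> t0; apply: ge_inf; last by exists t.
  (* Subadditivity on [s y = (x + s y) - x] shows the infimum to be over a set bounded below. *)
  exists (- p (- x)) => _ [s /= s0 <-].
  have := pD (x + s%:C *: y) (- x).
  by rewrite addrC addKr sublinearZ//; lra.
have qglb x c : (forall t, 0 <= t -> c <= p (x + t%:C *: y) - t * p y) -> c <= q x.
  move=> H; apply: lb_le_inf; first by exists (p (x + 0%:C *: y) - 0 * p y), 0 => /=.
  by move=> _ [t /= t0 <-]; exact: H.
exists q; split.
- split=> [x x'|r x r0].
    rewrite -lerBlDr; apply: (qglb) => t t0.
    rewrite lerBlDr -lerBlDl; apply: (qglb) => s s0.
    have := qlb (x + x') _ (addr_ge0 t0 s0).
    rewrite rmorphD /= scalerDl addrACA.
    have := pD (x + t%:C *: y) (x' + s%:C *: y); lra.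
  have [->|rn0] := eqVneq r 0.
    have := qlb 0 0 (lexx 0); rewrite scale0r !mul0r !addr0 (sublinear0 p ps).
    by rewrite subr0 scale0r.
  have rp : 0 < r by rewrite lt0r rn0.
  rewrite mulrC -ler_pdivrMr//; apply: (qglb) => t t0; rewrite ler_pdivrMr//.
  apply: le_trans (qlb _ (r * t) _) _; first exact: mulr_ge0.
  have -> : r%:C *: x + (r * t)%:C *: y = r%:C *: (x + t%:C *: y).
    by rewrite scalerDr scalerA rmorphM.
  by rewrite (sublinearZ p)//; lra.
- move=> x; have := qlb x 0 (lexx 0).
  by rewrite scale0r addr0 mul0r subr0.
- have := qlb (- y) 1 ler01.
  by rewrite scale1r addNr (sublinear0 p ps) mul1r sub0r.
Qed.

(* A minimal sublinear functional below [p] is linear. *)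
Lemma hahn_banach p : sublinear p -> exists g : V -> R,
  [/\ forall x, g x <= p x, forall x y, g (x + y) = g x + g y
    & forall r x, g (r%:C *: x) = r * g x].
Proof.
move=> ps.
pose T := {q : V -> R | sublinear q /\ forall x, q x <= p x}.
(* The order is reversed, so that a maximal element for Zorn's lemma is a minimal functional. *)
pose le (q q' : T) := `[< forall x, sval q' x <= sval q x >].
have p_in : sublinear p /\ forall x, p x <= p x by [].
have [||C Ctot|[q [qs qp]] qmax] := ZL_preorder (exist _ p p_in : T) (R := le).
- by move=> q; apply/asboolP.
- move=> r q s /asboolP qr /asboolP rs; apply/asboolP => x.
  exact: le_trans (rs x) (qr x).
- have [[q0 Cq0]|C0] := pselect (exists q : T, C q); last first.
    by exists (exist _ p p_in) => s Cs; case: C0; exists s.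
  (* The pointwise infimum bounds the chain; for its subadditivity, the smaller of two members
     serves at both points. *)
  pose S x := [set sval q x | q in C].
  pose m x := inf (S x).
  have mlb x (q : T) : C q -> m x <= sval q x.
    move=> Cq; apply: ge_inf; last by exists q.
    exists (- p (- x)) => _ [[q' [q's q'p]] _ <-] /=.
    by apply: le_trans (sublinearN _ _ q's); rewrite lerN2.
  have mglb x c : (forall q : T, C q -> c <= sval q x) -> c <= m x.
    move=> H; apply: lb_le_inf; first by exists (sval q0 x), q0.
    by move=> _ [q Cq <-]; exact: H.
  have mP : sublinear m /\ forall x, m x <= p x.
    split; last by move=> x; apply: le_trans (mlb x _ Cq0) _; case: q0 {Cq0} => ? [].
    split=> [x y|r x r0].
      rewrite -lerBlDr; apply: (mglb) => q Cq.
      rewrite lerBlDr -lerBlDl; apply: (mglb) => q' Cq'.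
      rewrite lerBlDl.
      have qD (s : T) : sval s (x + y) <= sval s x + sval s y.
        by case: s => ? [[? ?] ?] /=.
      have [/asboolP qq|/asboolP qq] := Ctot _ _ Cq Cq'.
        apply: le_trans (mlb _ _ Cq') _; apply: le_trans (qD _) _.
        by rewrite lerD2r.
      apply: le_trans (mlb _ _ Cq) _; apply: le_trans (qD _) _.
      by rewrite lerD2l.
    have [->|rn0] := eqVneq r 0.
      rewrite scale0r mul0r; apply: le_trans (mlb _ _ Cq0) _.
      by case: q0 {Cq0} => ? [? ?] /=; rewrite sublinear0.
    have rp : 0 < r by rewrite lt0r rn0.
    rewrite mulrC -ler_pdivrMr//; apply: (mglb) => q Cq; rewrite ler_pdivrMr//.
    apply: le_trans (mlb _ _ Cq) _.
    by case: q {Cq} => ? [? ?] /=; rewrite sublinearZ// mulrC.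
  by exists (exist _ m mP) => s Cs; apply/asboolP => x /=; exact: mlb.
(* Minimality forces the functional [s] obtained from [q] at [y] to equal [q], so
   [q (- y) <= - q y]. *)
have qN y : q (- y) = - q y.
  have [s [ss sq sy]] := sublinear_step _ y qs.
  have s_in : sublinear s /\ forall x, s x <= p x.
    by split=> // x; exact: le_trans (sq x) (qp x).
  have /asboolP /(_ (- y)) /= := qmax (exist _ s s_in) (asboolT sq).
  by have := sublinearN _ y qs; lra.
have [qD _] := qs.
exists q; split=> //.
  move=> x y; apply/eqP; rewrite eq_le qD /=.
  by have := qD (- x) (- y); rewrite -opprD !qN; lra.
move=> r x; have [r0|r0] := leP 0 r; first exact: sublinearZ.
have r0' : 0 <= - r by rewrite oppr_ge0 ltW.
have := sublinearZ q (- r) x qs r0'.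
by rewrite rmorphN scaleNr qN mulNr => /oppr_inj.
Qed.

End hahn_banach.

(** * From real functionals to states *)

Section state_existence.
Context {R : realType} {A : cstarAlgType R}.
Implicit Types (x y : A) (f : {linear A -> R[i]^o}).
Local Open Scope complex_scope.

Lemma contractive_state f : f 1 = 1 -> (forall x, Normc.normc (f x) <= nrm x) ->
  states A f.
Proof.
move=> f1 fle; split=> //.
  apply/linear_bounded_continuous/linear_boundedP.
  exists 1; split; first exact: real1.
  move=> r r1 x; apply: le_trans (_ : `|x| <= _).
    by rewrite normE; have := fle x; rewrite -lecR.
  by rewrite ler_peMl// ltW.
have ub : ubound [set Normc.normc (f x) | x in [set x : A | `|x| <= 1]] 1.
  by move=> _ [x /= x1 <-]; rewrite (le_trans (fle x))// nrm_le.
have in1 : [set Normc.normc (f x) | x in [set x : A | `|x| <= 1]] 1.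
  by exists 1 => /=; rewrite ?f1 ?Normc.normc1// normE nrm1.
apply/eqP; rewrite eq_le; apply/andP; split.
  by apply: ge_sup => //; exists 1.
by apply: ub_le_sup => //; exists 1.
Qed.

Lemma sublinear_nrm : sublinear (nrm : A -> R).
Proof.
split; first exact: nrmD.
by move=> r x r0; rewrite nrmZr ger0_norm.
Qed.

(** Lowering the norm at [1] gives [p (- 1) <= - 1], so a real-linear [g] below [p] has [g 1 = 1];
    its complexification is the state. *)
Lemma states_nonempty : exists f, states A f.
Proof.
have [p [ps ple p1]] := sublinear_step _ (1 : A) sublinear_nrm.
have [g [gp gD gZ]] := hahn_banach _ ps.
have gle x : g x <= nrm x := le_trans (gp x) (ple x).
have gN x : g (- x) = - g x.
  by have := gZ (-1) x; rewrite rmorphN1 scaleN1r mulN1r.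
have g1 : g 1 = 1.
  apply/eqP; rewrite eq_le -[leRHS](@nrm1 _ A) gle /= -(@nrm1 _ A) -lerN2 -gN.
  exact: le_trans (gp _) p1.
pose F x : R[i]^o := g x +i* (- g ('i *: x)).
have flin : linear F.
  move=> l x y; case: l => u v.
  have lE z : (u +i* v) *: z = u%:C *: z + v%:C *: ('i *: z).
    rewrite scalerA -scalerDl; congr (_ *: _).
    by apply/eqP; rewrite eq_complex /=; apply/andP; split; apply/eqP; ring.
  have iE z : 'i *: ((u +i* v) *: z) = u%:C *: ('i *: z) + (- v)%:C *: z.
    rewrite !scalerA -scalerDl; congr (_ *: _).
    by apply/eqP; rewrite eq_complex /=; apply/andP; split; apply/eqP; ring.
  rewrite /F scalerDr iE lE !gD !gZ.
  by apply/eqP; rewrite eq_complex /=; apply/andP; split; apply/eqP; ring.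
pose f : {linear A -> R[i]^o} :=
  HB.pack F (GRing.isLinear.Build R[i] A R[i]^o *:%R F flin).
have fle x : Normc.normc (f x) <= nrm x.
  have [->|fx0] := eqVneq (f x) 0; first by rewrite Normc.normc0 nrm_ge0.
  pose r := Normc.normc (f x).
  have r0 : r != 0 by apply: contra fx0 => /eqP/Normc.eq0_normc/eqP.
  (* A phase rotating [f x] onto its modulus, so that the bound on the real part [g] bounds the
     modulus. *)
  pose l := conjc (f x) / r%:C.
  have lf : f (l *: x) = r%:C.
    rewrite linearZ /= -[LHS]/(l * f x) /l mulrAC.
    have -> : conjc (f x) * f x = (r ^+ 2)%:C.
      rewrite /r normc_sqr; case: (f x) => u v.
      by apply/eqP; rewrite eq_complex /=; apply/andP; split; apply/eqP; ring.
    by rewrite rmorphXn /= expr2 mulfK// fmorph_eq0.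
  have l1 : Normc.normc l = 1.
    rewrite Normc.normcM Normc.normcV.
    have -> : Normc.normc (conjc (f x)) = r.
      by rewrite /r; case: (f x) => u v /=; rewrite sqrrN.
    have -> : Normc.normc r%:C = r.
      by rewrite /= expr0n addr0 sqrtr_sqr ger0_norm ?normc_ge0.
    by rewrite divff.
  have : complex.Re (f (l *: x)) <= nrm (l *: x) by exact: gle.
  by rewrite lf nrmZ l1 mul1r.
exists f; apply: contractive_state => //.
(* Real part 1 and modulus at most 1 force [f 1] to have imaginary part 0. *)
have := fle 1; rewrite nrm1 -(@ler_pXn2r _ 2) ?nnegrE ?normc_ge0// normc_sqr /= g1.
rewrite expr1n gerDl => gi0.
have gi : g ('i *: 1) = 0.
  by apply/eqP; rewrite -sqrf_eq0 eq_le sqr_ge0 andbT -sqrrN.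
by change (F 1 = 1); rewrite /F g1 gi oppr0.
Qed.

End state_existence.

(** * The nabla norm *)

Section nabla.
Context {R : realType} {A : cstarAlgType R}.
Implicit Types (x y a b : A) (f : {linear A -> R[i]^o}).
Local Open Scope complex_scope.

Lemma sqrt_qform_le f a : states A f -> Num.sqrt (qform f a) <= nrm a.
Proof.
move=> fs; rewrite -(ger0_norm (nrm_ge0 a)) -sqrtr_sqr ler_sqrt ?sqr_ge0//.
exact: qform_le.
Qed.

Lemma sqrt_qform_le_nabla f a : states A f ->
  Num.sqrt (qform f a) <= nabla_norm a.
Proof.
move=> fs; apply: ub_le_sup; last by exists f.
by exists (nrm a) => _ [g gs <-]; exact: sqrt_qform_le.
Qed.

Lemma nabla_norm_ge0 a : 0 <= nabla_norm a.
Proof.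
have [f fs] := @states_nonempty R A.
exact: le_trans (sqrtr_ge0 _) (sqrt_qform_le_nabla _ a fs).
Qed.

Lemma nabla_norm_le a (c : R) :
  (forall f, states A f -> Num.sqrt (qform f a) <= c) -> nabla_norm a <= c.
Proof.
move=> H; have [f fs] := @states_nonempty R A.
apply: ge_sup; first by exists (Num.sqrt (qform f a)), f.
by move=> _ [g gs <-]; exact: H.
Qed.

Lemma nabla_norm_approx a (e : R) : 0 < e ->
  exists2 f, states A f & nabla_norm a - e < Num.sqrt (qform f a).
Proof.
move=> e0; have [f0 fs0] := @states_nonempty R A.
have [|_ [f fs <-] lt_f] :=
  @sup_adherent R [set Num.sqrt (qform f a) | f in states A] e e0.
  split; first by exists (Num.sqrt (qform f0 a)), f0.
  by exists (nrm a) => _ [g gs <-]; exact: sqrt_qform_le.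
by exists f.
Qed.

(** For each state, [form_le] bounds [qform f (a + b)] by the square of the sum of the two roots. *)
Lemma nabla_normD a b : nabla_norm (a + b) <= nabla_norm a + nabla_norm b.
Proof.
apply: nabla_norm_le => f fs.
apply: (@le_trans _ _ (Num.sqrt (qform f a) + Num.sqrt (qform f b))); last first.
  by apply: lerD; exact: sqrt_qform_le_nabla.
have s0 : 0 <= Num.sqrt (qform f a) + Num.sqrt (qform f b).
  by rewrite addr_ge0 ?sqrtr_ge0.
rewrite -(ger0_norm s0) -sqrtr_sqr ler_sqrt ?sqr_ge0// qformD// sqrrD.
rewrite !sqr_sqrtr ?qform_ge0//; have := form_le f a b fs; lra.
Qed.

Lemma nabla_normN a : nabla_norm (- a) = nabla_norm a.
Proof.
rewrite /nabla_norm; congr sup; apply: eq_imagel => f fs.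
have := qformZ f (-1) a; rewrite rmorphN1 scaleN1r sqrrN expr1n mul1r.
by move=> e; congr Num.sqrt; exact: e.
Qed.

Lemma form_le_nabla f a b : states A f ->
  form f a b <= 2 * nabla_norm a * nabla_norm b.
Proof.
move=> fs; apply: le_trans (form_le _ _ _ fs) _.
by rewrite -!mulrA ler_wpM2l// ler_pM ?sqrtr_ge0 ?sqrt_qform_le_nabla.
Qed.

End nabla.

(** * Equality in the triangle inequality *)

Theorem theorem2p5 (R : realType) (A : cstarAlgType R) (a b : A) :
  nabla_norm (a + b) = nabla_norm a + nabla_norm b
  <->
  exists2 f : nat -> {linear A -> R[i]^o},
    forall n, states A (f n)
    & complex.Re (f n (star b * a) + conjc (f n a) * f n b) @[n --> \oo]
        --> 2 * nabla_norm a * nabla_norm b.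
Proof.
set S := nabla_norm (a + b); set p := nabla_norm a; set q := nabla_norm b.
have p0 : 0 <= p := nabla_norm_ge0 a.
have q0 : 0 <= q := nabla_norm_ge0 b.
have le_sqr c f : states A f -> qform f c <= nabla_norm c ^+ 2.
  move=> fs; rewrite -[leLHS]sqr_sqrtr ?qform_ge0//.
  by rewrite ler_pXn2r ?nnegrE ?sqrtr_ge0 ?nabla_norm_ge0 ?sqrt_qform_le_nabla.
split=> [Sadd|[f fs fcvg]].
- have ex n : exists f, states A f /\ S - n.+1%:R^-1 < Num.sqrt (qform f (a + b)).
    have [|f ? ?] := nabla_norm_approx (a + b) n.+1%:R^-1; first by rewrite invr_gt0.
    by exists f.
  have [f fP] := choice ex.
  have fs n : states A (f n) by have [] := fP n.
  exists f => //.
  pose s n := Num.sqrt (qform (f n) (a + b)).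
  have scvg : s n @[n --> \oo] --> S.
    apply: (@squeeze_cvgr _ _ _ _ (fun n => S - n.+1%:R^-1) (fun=> S)).
    + near=> n; rewrite (ltW (fP n).2) /=.
      exact: sqrt_qform_le_nabla.
    + rewrite -[X in _ --> X]subr0; apply: cvgB; first exact: cvg_cst.
      exact: cvg_harmonic.
    + exact: cvg_cst.
  (* The form is [s n ^+ 2] minus the values of [qform] at [a] and [b], which are at most [p ^+ 2]
     and [q ^+ 2]; the lower bound tends to [(p + q) ^ 2 - p ^ 2 - q ^ 2]. *)
  apply: (@squeeze_cvgr _ _ _ _ (fun n => s n ^+ 2 - p ^+ 2 - q ^+ 2)
    (fun=> 2 * p * q)).
  + near=> n; apply/andP; split; last exact: form_le_nabla.
    rewrite -/(form (f n) a b) sqr_sqrtr ?qform_ge0// qformD//.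
    have := le_sqr a _ (fs n); have := le_sqr b _ (fs n); rewrite -/p -/q; lra.
  + have -> : 2 * p * q = S ^+ 2 - p ^+ 2 - q ^+ 2 by rewrite Sadd; ring.
    apply: cvgB; last exact: cvg_cst; apply: cvgB; last exact: cvg_cst.
    rewrite expr2; under eq_cvg do rewrite expr2; exact: cvgM.
  + exact: cvg_cst.
- apply/eqP; rewrite eq_le nabla_normD /=.
  (* When [p = 0], writing [b = (a + b) - a] gives [q <= S] directly; likewise when [q = 0]. *)
  have [pz|pn0] := eqVneq p 0.
    have := nabla_normD (a + b) (- a).
    by rewrite nabla_normN -/S -/p pz addr0 add0r addrC addKr.
  have [qz|qn0] := eqVneq q 0.
    have := nabla_normD (a + b) (- b).
    by rewrite nabla_normN -/S -/q qz addr0 addr0 addrK.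
  have pp : 0 < p by rewrite lt0r pn0.
  have qp : 0 < q by rewrite lt0r qn0.
  (* Chosen so that [c * k <= S ^ 2 + p ^ 2 + q ^ 2] for each value [c] of the form. This bound is
     linear in [c], so it passes to the limit, where [2 p q k = 2 p ^ 2 + 2 q ^ 2 + 2 p q] yields
     [(p + q) ^ 2 <= S ^ 2]. *)
  pose k := p / q + q / p + 1.
  have kp : 0 < k by rewrite !addr_gt0 ?divr_gt0.
  have lim_le : 2 * p * q <= (S ^+ 2 + p ^+ 2 + q ^+ 2) / k.
    rewrite -(cvg_lim (@Rhausdorff R) fcvg); apply: limr_le; first by apply: cvgP fcvg.
    near=> n; rewrite -/(form (f n) a b) ler_pdivlMr//.
    set c := form _ _ _.
    have := le_sqr (a + b) _ (fs n); rewrite qformD// -/c -/S.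
    have qa := qform_ge0 _ a (fs n); have qb := qform_ge0 _ b (fs n).
    rewrite -(sqr_sqrtr qa) -(sqr_sqrtr qb).
    have := form_le _ a b (fs n); rewrite -/c.
    have := sqrt_qform_le_nabla _ a (fs n); rewrite -/p.
    have := sqrt_qform_le_nabla _ b (fs n); rewrite -/q.
    have := sqrtr_ge0 (qform (f n) a); have := sqrtr_ge0 (qform (f n) b).
    (* [u] belongs to [b] and [v] to [a]; from [c <= 2 u v] come lower bounds on each, combined
       below with [2 p v <= p ^ 2 + v ^ 2] and [2 q u <= q ^ 2 + u ^ 2]. *)
    set u := Num.sqrt _; set v := Num.sqrt _ => u0 v0 uq vp cuv cS.
    have cu : c / (2 * p) <= u.
      rewrite ler_pdivrMr ?mulr_gt0//; apply: le_trans cuv _.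
      by nra.
    have cv : c / (2 * q) <= v.
      rewrite ler_pdivrMr ?mulr_gt0//; apply: le_trans cuv _.
      by nra.
    have -> : c * k = 2 * p * (c / (2 * q)) + 2 * q * (c / (2 * p)) + c.
      by rewrite /k; field; rewrite pn0 qn0.
    have := ler_wpM2l (ltW pp) cv; have := ler_wpM2l (ltW qp) cu.
    have := sqr_ge0 (v - p); have := sqr_ge0 (u - q).
    by rewrite !sqrrB; lra.
  have S0 : 0 <= S := nabla_norm_ge0 _.
  rewrite -(@ler_pXn2r _ 2) ?nnegrE ?addr_ge0//.
  move: lim_le; rewrite ler_pdivlMr//.
  have -> : 2 * p * q * k = 2 * p ^+ 2 + 2 * q ^+ 2 + 2 * p * q.
    by rewrite /k; field; rewrite pn0 qn0.
  rewrite sqrrD; lra.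
Unshelve. all: by end_near. Qed.
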